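(* Let $n$, $k$ and $t$ be positive integers with $n\geq k\geq t+2$. Let $\mathcal{F}\subseteq\binom{[n]}{k}$ be a maximal $t$-intersecting family such that $\tau_t(\mathcal{F})=t+1$. Then $\mathcal{F}$ is isomorphic to one of the following families $\mathcal{F}'$: (i) $\mathcal{F}'=\{F\in\binom{[n]}{k}: |F\cap[t+2]|\geq t+1\}$; (ii) $\mathcal{F}'=\{F\in\binom{[n]}{k}: [t]\subseteq F,\ |F\cap[t+1,k+1]|\geq 1\}\cup\{[k+1]\setminus\{i\}: i\in[t]\}$; (iii) $\mathcal{F}'=\bigcup_{i\in[t+1]}\{A\cup([t+1]\setminus\{i\}): A\in\mathcal{A}_i\}\cup\{F\in\binom{[n]}{k}:[t+1]\subseteq F\}$, where $\mathcal{A}_i\subseteq\binom{[t+2,n]}{k-t}$, $i=1,\dots,t+1$, are maximal pairwise cross intersecting families with at least two of them being non-empty; (iv) $\mathcal{F}'=\{F\in\binom{[n]}{k}: [t]\subseteq F,\ |F\cap[m]|\geq t+1\}\cup\{A\cup[t]: A\in\mathcal{A}\}\cup\{B\cup([m]\setminus\{i\}): i\in[t],\ B\in\mathcal{B}\}$, where $m\in[t+2,k]$, and $\mathcal{A}\subseteq\binom{[m+1,n]}{k-t}$ and $\mathcal{B}\subseteq\binom{[m+1,n]}{k-m+1}$ are a pair of maximal cross intersecting families with $\mathcal{B}\neq\emptyset$.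
   Context: Notation: $[a,b]=\{a,a+1,\dots,b\}$, $[n]=[1,n]$; $\binom{M}{k}$ is the family of all $k$-subsets of $M$. A family $\mathcal{F}\subseteq\binom{[n]}{k}$ is $t$-intersecting if $|F\cap F'|\geq t$ for all $F,F'\in\mathcal{F}$; it is maximal if it is not properly contained in another $t$-intersecting family of $k$-subsets of $[n]$. The $t$-covering number $\tau_t(\mathcal{F})$ is the minimum size of a set $T\subseteq[n]$ with $|T\cap F|\geq t$ for all $F\in\mathcal{F}$. Two families are isomorphic if some permutation of $[n]$ maps one onto the other. Families $\mathcal{F}_1,\dots,\mathcal{F}_r$ of $k_1$-subsets, ..., $k_r$-subsets, respectively, of a ground set are pairwise cross intersecting if $F_i\cap F_j\neq\emptyset$ for all $F_i\in\mathcal{F}_i$, $F_j\in\mathcal{F}_j$ with distinct $i,j\in[r]$ (for $r=2$: cross intersecting). Empty families are allowed. They are maximal if $\mathcal{F}_i=\mathcal{F}_i'$ for all $i$ whenever $\mathcal{F}'_1,\dots,\mathcal{F}'_r$ are pairwise cross intersecting families of $k_1$-, ..., $k_r$-subsets of the same ground set with $\mathcal{F}_i\subseteq\mathcal{F}'_i$ for all $i$. In (iii) the ground set is $[t+2,n]$, and in (iv) it is $[m+1,n]$. *)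

(* Defs.v *)
From mathcomp Require Import all_boot all_fingroup.

Set Implicit Arguments.
Unset Strict Implicit.
Unset Printing Implicit Defensive.

Section Families.
Variable T : finType.
Implicit Types (M : {set T}) (F G : {set {set T}}).

Definition ksubsets M (k : nat) : {set {set T}} :=
  [set A : {set T} | A \subset M & #|A| == k].

Definition intersecting (t : nat) F : bool :=
  [forall A in F, forall B in F, t <= #|A :&: B|].

Definition maximal_intersecting (k t : nat) F : bool :=
  maxset (fun G => (G \subset ksubsets [set: T] k) && intersecting t G) F.

Definition covers (t : nat) F (C : {set T}) : bool :=
  [forall A in F, t <= #|C :&: A|].

(* If some member of F has fewer than t elements, there is no cover and the
   value is #|T| by default. *)
Definition covering_number (t : nat) F : nat :=
  #|[arg min_(C < [set: T] | covers t F C) #|C| ]|.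

Definition isomorphic F G : Prop :=
  exists s : {perm T}, [set s @: A | A : {set T} in F] = G.

Section Cross.
Variable I : finType.

Definition cross_intersecting M (k : I -> nat) (A : I -> {set {set T}}) : Prop :=
  (forall i, A i \subset ksubsets M (k i)) /\
  (forall i j, i != j ->
     forall X Y, X \in A i -> Y \in A j -> X :&: Y != set0).

Definition maximal_cross_intersecting M (k : I -> nat)
    (A : I -> {set {set T}}) : Prop :=
  cross_intersecting M k A /\
  (forall A' : I -> {set {set T}}, cross_intersecting M k A' ->
     (forall i, A i \subset A' i) -> forall i, A i = A' i).

End Cross.
End Families.

(* The ground set {1, ..., n} is 'I_n, with x : 'I_n standing for the number
   x.+1; seg n a b is {a, ..., b}, truncated to {1, ..., n}. *)
Definition seg (n a b : nat) : {set 'I_n} := [set x : 'I_n | a <= x.+1 <= b].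

Section ListedFamilies.
Variables n k t : nat.

Definition family_i : {set {set 'I_n}} :=
  [set F in ksubsets [set: 'I_n] k | t.+1 <= #|F :&: seg n 1 (t + 2)|].

Definition family_ii : {set {set 'I_n}} :=
  [set F in ksubsets [set: 'I_n] k
     | (seg n 1 t \subset F) && (1 <= #|F :&: seg n t.+1 k.+1|)]
  :|: [set seg n 1 k.+1 :\ i | i in seg n 1 t].

(* The index i : 'I_t.+1 stands for the number i.+1, as for elements of 'I_n. *)
Definition family_iii (A : 'I_t.+1 -> {set {set 'I_n}}) : {set {set 'I_n}} :=
  (\bigcup_(i : 'I_t.+1)
     [set X :|: [set x in seg n 1 t.+1 | x != i :> nat] | X : {set 'I_n} in A i])
  :|: [set F in ksubsets [set: 'I_n] k | seg n 1 t.+1 \subset F].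

Definition family_iv (m : nat) (A B : {set {set 'I_n}}) : {set {set 'I_n}} :=
  [set F in ksubsets [set: 'I_n] k
     | (seg n 1 t \subset F) && (t.+1 <= #|F :&: seg n 1 m|)]
  :|: [set X :|: seg n 1 t | X : {set 'I_n} in A]
  :|: [set Y :|: (seg n 1 m :\ i) | i in seg n 1 t, Y in B].

End ListedFamilies.

(* Main.v *)
Require Import Defs.
From mathcomp Require Import all_boot all_fingroup.
From mathcomp Require Import zify.

(** The third alternative describes every family of the theorem. Fix a
    t-cover S of F of size t + 1 and move it onto {1, ..., t + 1} by a
    permutation. Every member of F meets S in at least t elements, so it either
    contains S or has the form X :|: (S :\ x) with x in S and X disjoint from S.

    A maximal t-intersecting family is its own polar
    ([maximal_intersecting_self_polar]): a k-set belongs to F as soon as it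
    meets every member of F in at least t elements. Thus all k-sets containing
    S are in F, and F is determined by its links at S, the sets A x of those X
    with X :|: (S :\ x) in F. Two members X :|: (S :\ x) and Y :|: (S :\ y)
    automatically share t elements if x = y, whereas if x != y they share only
    t - 1 elements of S. Hence F is t-intersecting exactly when its links are
    pairwise cross intersecting, and the maximality of F becomes the maximality
    of the links ([maximal_links]). Finally, if at most one link A x were
    nonempty, S :\ x would be a t-cover of size t, against the minimality of
    t + 1 ([two_nonempty_links]). *)

Set Implicit Arguments.
Unset Strict Implicit.
Unset Printing Implicit Defensive.

(** * Self-polar families, their covers and permutations *)

Section SelfPolar.
Variable T : finType.
Implicit Types (F : {set {set T}}) (C X Y : {set T}).

Definition self_polar k t F : Prop :=
  forall X, X \in F <-> #|X| = k /\ (forall Y, Y \in F -> t <= #|X :&: Y|).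

Lemma coversP t F C :
  reflect (forall X, X \in F -> t <= #|C :&: X|) (covers t F C).
Proof. exact: forall_inP. Qed.

(** A k-set X meeting every member in at least t elements can be added to the
    family; the bound t <= k takes care of the pair (X, X). *)
Lemma maximal_intersecting_self_polar k t F :
  t <= k -> maximal_intersecting k t F -> self_polar k t F.
Proof.
move=> le_tk /maxsetP[/andP[/subsetP unifF /forall_inP intF] maxF] X; split.
  move=> FX; split; first by have := unifF X FX; rewrite inE => /andP[_ /eqP].
  by move=> Y FY; exact: (forall_inP (intF X FX)).
case=> cardX meetX; suff <-: X |: F = F by exact: setU11.
apply: maxF; last exact: subsetUr.
apply/andP; split.
  apply/subsetP=> Y /setU1P[->|/unifF//].
  by rewrite inE subsetT cardX eqxx.
apply/forall_inP=> Y /setU1P[->|FY]; apply/forall_inP=> Z /setU1P[->|FZ].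
- by rewrite setIid cardX.
- exact: meetX.
- by rewrite setIC; exact: meetX.
- exact: (forall_inP (intF Y FY)).
Qed.

(** Members of size at least t make the whole ground set a cover, so the
    minimum defining the covering number is attained at a cover. *)
Lemma covering_numberP k t F : t <= k -> self_polar k t F ->
  (exists2 C, covers t F C & #|C| = covering_number t F) /\
  (forall C, covers t F C -> covering_number t F <= #|C|).
Proof.
move=> le_tk polF; rewrite /covering_number.
case: arg_minnP => [|C covC minC].
  by apply/coversP=> X /polF[cardX _]; rewrite setTI cardX.
by split; first exists C.
Qed.

Section Transport.
Variable s : {perm T}.

Let image F : {set {set T}} := [set s @: X | X : {set T} in F].

Lemma card_meet_perm X Y : #|(s @: X) :&: (s @: Y)| = #|X :&: Y|.
Proof.
by rewrite -imsetI ?card_imset //; [exact: perm_inj | move=> ? ? _ _; exact: perm_inj].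
Qed.

Lemma imset_permVK X : s @: ((s^-1)%g @: X) = X.
Proof. by rewrite -imset_comp -[RHS]imset_id; apply: eq_imset => x /=; rewrite permKV. Qed.

Lemma mem_image F X : (s @: X \in image F) = (X \in F).
Proof. by rewrite mem_imset //; apply: imset_inj; exact: perm_inj. Qed.

Lemma self_polar_image k t F : self_polar k t F -> self_polar k t (image F).
Proof.
move=> polF X; rewrite -(imset_permVK X); move: (_ @: X) => {}X.
rewrite mem_image card_imset; last exact: perm_inj.
split=> [/polF[cardX meetX]|[cardX meetX]].
  by split=> // _ /imsetP[Y FY ->]; rewrite card_meet_perm; exact: meetX.
apply/polF; split=> // Y FY; rewrite -card_meet_perm; apply: meetX.
by rewrite mem_image.
Qed.

Lemma covers_image t F C : covers t (image F) (s @: C) = covers t F C.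
Proof.
apply/coversP/coversP => [covC X FX | covC _ /imsetP[X FX ->]].
  by rewrite -card_meet_perm; apply: covC; rewrite mem_image.
by rewrite card_meet_perm; exact: covC.
Qed.

End Transport.

(** The permutation matches an enumeration of C followed by its complement
    with one of D followed by its complement. *)
Lemma perm_of_card_eq (C D : {set T}) : #|C| = #|D| -> exists s : {perm T}, s @: C = D.
Proof.
move=> eqCD.
pose l (B : {set T}) := enum B ++ enum (~: B).
have sz B : size (l B) = #|T| by rewrite size_cat -!cardE cardsC.
have lU B : uniq (l B).
  rewrite cat_uniq !enum_uniq andbT /=.
  by apply/hasPn=> x; rewrite !mem_enum inE.
have lall B x : x \in l B by rewrite mem_cat !mem_enum inE orbN.
pose f x := nth x (l D) (index x (l C)).
have f_inj : injective f.
  move=> x y; rewrite /f (set_nth_default y) ?sz -?(sz C) ?index_mem //.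
  move/eqP; rewrite nth_uniq ?sz -?(sz C) ?index_mem // => /eqP eq_ix.
  by rewrite -(nth_index x (lall C x)) eq_ix nth_index.
exists (perm f_inj); apply/eqP; rewrite eqEcard card_imset; last exact: perm_inj.
rewrite eqCD leqnn andbT; apply/subsetP=> _ /imsetP[x Cx ->].
rewrite permE /f index_cat mem_enum Cx nth_cat -cardE -eqCD.
have lt_i : index x (enum C) < #|C| by rewrite cardE index_mem mem_enum.
by rewrite lt_i -mem_enum mem_nth // -cardE -eqCD.
Qed.

End SelfPolar.

(** * Links of a self-polar family at a cover of size t + 1 *)

Section Links.
Variables (T I : finType) (e : I -> T) (k t : nat) (F : {set {set T}}).
Hypotheses (e_inj : injective e) (cardI : #|I| = t.+1) (le_tk : t <= k).
Hypothesis polF : self_polar k t F.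

Let S := [set e i | i : I].
Hypothesis covS : covers t F S.

(** The cover S is presented by an injective labelling e of its elements, so
    that the links form a family indexed by the labels. *)
Definition link (i : I) : {set {set T}} :=
  [set X in ksubsets (~: S) (k - t) | X :|: (S :\ e i) \in F].

Let in_S i : e i \in S. Proof. exact: imset_f. Qed.

Let cardS : #|S| = t.+1. Proof. by rewrite card_imset. Qed.

Lemma card_core i : #|S :\ e i| = t.
Proof. by have := cardsD1 (e i) S; rewrite in_S cardS => -[]. Qed.

Lemma card_core_meet i j : i != j -> #|(S :\ e i) :&: (S :\ e j)|.+1 = t.
Proof.
move=> neq_ij; rewrite -(card_core i) (cardsD1 (e j) (S :\ e i)).
rewrite !inE in_S (inj_eq e_inj) eq_sym neq_ij add1n; congr _.+1; congr #|pred_of_set _|.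
by apply/setP=> x; rewrite !inE; case: (x \in S); rewrite ?andbF ?andbT // andbC.
Qed.

Lemma link_sub i : link i \subset ksubsets (~: S) (k - t).
Proof. by apply/subsetP=> X; rewrite inE => /andP[]. Qed.

Lemma card_extension (X : {set T}) i :
  X \in ksubsets (~: S) (k - t) -> #|X :|: (S :\ e i)| = k.
Proof.
rewrite inE => /andP[/subsetP sXS /eqP cardX].
rewrite cardsU card_core cardX (_ : _ :&: _ = set0) ?cards0; first by lia.
apply/setP=> x; rewrite !inE.
by case Xx: (x \in X) => //; have := sXS x Xx; rewrite inE => /negbTE ->; rewrite andbF.
Qed.

Lemma card_meet_extension (X Y : {set T}) i j : X \subset ~: S -> Y \subset ~: S ->
  #|(X :|: (S :\ e i)) :&: (Y :|: (S :\ e j))|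
    = #|X :&: Y| + #|(S :\ e i) :&: (S :\ e j)|.
Proof.
move=> /subsetP sXS /subsetP sYS; rewrite -cardsUI.
rewrite [X in _ = _ + #|pred_of_set X|](_ : _ = set0) ?cards0 ?addn0; last first.
  apply/setP=> x; rewrite !inE; case Xx: (x \in X) => //.
  by have := sXS x Xx; rewrite inE => /negbTE ->; rewrite !andbF.
congr #|pred_of_set _|; apply/setP=> x; rewrite !inE.
have := sXS x; have := sYS x; rewrite !inE.
by case: (x \in X); case: (x \in Y); case: (x \in S) => // a b;
  rewrite ?andbF ?orbF //; first [have := a isT | have := b isT].
Qed.

(** Every member of F already meets S in at least t elements. *)
Lemma supset_cover_mem (X : {set T}) : #|X| = k -> S \subset X -> X \in F.
Proof.
move=> cardX sSX; apply/polF; split=> // Y FY.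
by apply: leq_trans (coversP _ _ _ covS Y FY) _; rewrite subset_leq_card ?setSI.
Qed.

(** A member meets S in at least t of its t + 1 elements, so it misses at
    most one of them. *)
Lemma mem_link_or_supset (X : {set T}) : X \in F -> ~~ (S \subset X) ->
  exists2 i, X :\: S \in link i & X = (X :\: S) :|: (S :\ e i).
Proof.
move=> FX /subsetPn[_ /imsetP[i _ ->] nXi].
have defI : X :&: S = S :\ e i.
  apply/eqP; rewrite eqEcard card_core setIC (coversP _ _ _ covS) // andbT.
  apply/subsetP=> x; rewrite !inE => /andP[-> Xx]; rewrite andbT.
  by apply: contraNneq nXi => <-.
have defX : X = (X :\: S) :|: (S :\ e i) by rewrite -defI setUC setID.
exists i => //; rewrite !inE -defX FX andbT.
have [cardX _] := (polF X).1 FX.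
have := cardsID S X; rewrite defI card_core cardX => eqk.
by apply/andP; split; [apply/subsetP=> x; rewrite !inE => /andP[] | apply/eqP; lia].
Qed.

Lemma links_decomposition :
  F = (\bigcup_i [set X :|: (S :\ e i) | X : {set T} in link i])
        :|: [set X in ksubsets [set: T] k | S \subset X].
Proof.
apply/setP=> X; apply/idP/setUP => [FX | [/bigcupP[i _ /imsetP[Y]] | ]].
- have [sSX|nSX] := boolP (S \subset X).
    by right; rewrite !inE subsetT sSX (proj1 ((polF X).1 FX)) eqxx.
  left; have [i AX defX] := mem_link_or_supset FX nSX.
  by apply/bigcupP; exists i => //; apply/imsetP; exists (X :\: S).
- by rewrite inE => /andP[_ FY] ->.
- by rewrite !inE subsetT => /andP[/eqP]; exact: supset_cover_mem.
Qed.

(** Extensions with different indices share t - 1 elements of S, so a further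
    common element must come from outside S. *)
Lemma links_cross_intersecting :
  cross_intersecting (~: S) (fun=> k - t) link.
Proof.
split=> [|i j neq_ij X Y]; first exact: link_sub.
case/setIdP=> /setIdP[sX _] FX /setIdP[/setIdP[sY _] FY].
have := proj2 ((polF _).1 FX) _ FY; rewrite card_meet_extension //.
by have := card_core_meet neq_ij; rewrite -card_gt0; lia.
Qed.

(** If cross intersecting families A' contain the links, the extension of a
    set in A' i meets every member of F in at least t elements, so it already
    belongs to F. *)
Lemma maximal_links : maximal_cross_intersecting (~: S) (fun=> k - t) link.
Proof.
split=> [|A' [unifA' crossA'] sAA' i]; first exact: links_cross_intersecting.
apply/eqP; rewrite eqEsubset sAA' /=; apply/subsetP=> X A'X.
have kX := subsetP (unifA' i) X A'X.
rewrite inE kX; apply/polF; split=> [|Y FY]; first exact: card_extension.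
have [sSY|nSY] := boolP (S \subset Y).
  rewrite -(card_core i) subset_leq_card // subsetI subsetUr.
  by apply: subset_trans sSY; exact: subsetDl.
have [j AY defY] := mem_link_or_supset FY nSY.
have A'Y := subsetP (sAA' j) _ AY.
have kY := subsetP (unifA' j) _ A'Y.
have [[sX _] [sY _]] := (setIdP kX, setIdP kY).
rewrite defY card_meet_extension //.
have [->|neq_ij] := eqVneq i j; first by rewrite setIid card_core leq_addl.
have := crossA' i j neq_ij _ _ A'X A'Y; rewrite -card_gt0.
by have := card_core_meet neq_ij; lia.
Qed.

Lemma two_nonempty_links :
  (forall C, covers t F C -> t < #|C|) -> 1 < #|[set i | link i != set0]|.
Proof.
move=> minC; rewrite ltnNge; apply/negP=> /card_le1_eqP le1.
(* If every link is empty, any element of the nonempty index type will do. *)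
have [i onlyi] : exists i, forall j, link j != set0 -> j = i.
  have [i Ai|none] := pickP (fun i => link i != set0).
    by exists i => j Aj; apply: le1; rewrite inE.
  have /card_gt0P[i _] : 0 < #|I| by rewrite cardI.
  by exists i => j; rewrite none.
suff /minC : covers t F (S :\ e i) by rewrite card_core ltnn.
apply/coversP=> X FX; rewrite -{1}(card_core i) subset_leq_card // subsetI subxx.
have [sSX|nSX] := boolP (S \subset X).
  by apply: subset_trans sSX; exact: subsetDl.
have [j AX ->] := mem_link_or_supset FX nSX.
by rewrite (onlyi j) ?subsetUr //; apply/set0Pn; exists (X :\: S).
Qed.

End Links.

(** * The classification *)

Theorem theorem1p2 (n k t : nat) (n_gt0 : 0 < n) (k_gt0 : 0 < k) (t_gt0 : 0 < t)
    (le_kn : k <= n) (le_tk : t + 2 <= k) (F : {set {set 'I_n}})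
    (maxF : maximal_intersecting k t F) (tauF : covering_number t F = t + 1) :
  [\/ isomorphic F (family_i n k t),
      isomorphic F (family_ii n k t),
      exists A : 'I_t.+1 -> {set {set 'I_n}},
        [/\ maximal_cross_intersecting (seg n (t + 2) n) (fun _ => k - t) A,
            1 < #|[set i | A i != set0]|
          & isomorphic F (family_iii k A)]
    | exists (m : nat) (A B : {set {set 'I_n}}),
        [/\ t + 2 <= m <= k,
            maximal_cross_intersecting (seg n m.+1 n)
              (fun b : bool => if b then k - t else k - m + 1)
              (fun b : bool => if b then A else B),
            B != set0
          & isomorphic F (family_iv k t m A B)]].
Proof.
have le_t1n : t.+1 <= n by lia.
have {}le_tk : t <= k by lia.
pose e := widen_ord le_t1n.
have e_inj : injective e by move=> i j /(congr1 val) /= /val_inj.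
have defS : [set e i | i : 'I_t.+1] = seg n 1 t.+1.
  apply/setP=> x; rewrite inE /=; apply/imsetP/idP => [[i _ ->] | lt_x].
    exact: (ltn_ord i).
  by exists (Ordinal lt_x) => //; apply: val_inj.
have defSC : ~: seg n 1 t.+1 = seg n (t + 2) n.
  by apply/setP=> x; rewrite !inE /= ltn_ord andbT addn2 -ltnNge.
have polF := maximal_intersecting_self_polar le_tk maxF.
have [[C covC cardC] minC] := covering_numberP le_tk polF.
have [s defC] : exists s : {perm 'I_n}, s @: C = [set e i | i : 'I_t.+1].
  apply: perm_of_card_eq.
  by rewrite cardC tauF card_imset // card_ord addn1.
have polG := self_polar_image s polF.
have covS : covers t [set s @: X | X : {set 'I_n} in F] [set e i | i : 'I_t.+1].
  by rewrite -defC covers_image.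
apply: Or43; exists (link e k t [set s @: X | X : {set 'I_n} in F]); split.
- by rewrite -defSC -defS; apply: maximal_links => //; rewrite card_ord.
- apply: two_nonempty_links => //; first by rewrite card_ord.
  move=> D; rewrite -(imset_permVK s D); move: (_ @: D) => {}D.
  rewrite covers_image card_imset; last exact: perm_inj.
  by move/minC; rewrite tauF addn1.
exists s; rewrite {1}(links_decomposition e_inj (card_ord _) le_tk polG covS).
rewrite /family_iii defS; congr (_ :|: _); apply: eq_bigr => i _.
apply: eq_imset => X; congr (_ :|: _).
by apply/setP=> x; rewrite !inE andbC.
Qed.
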